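(* Let $\mathbb{F}=\mathbb{R}$ or $\mathbb{C}$ and assume that $\mathcal{A}=(A_j)_{j=1}^N\in \mathbf{H}_d(\mathbb{F})^N$ has the almost everywhere phase retrieval property on $\mathbb{F}^d$. Then $N\geq d$ if $\mathbb{F}=\mathbb{R}$, and $N\geq 2d-1$ if $\mathbb{F}=\mathbb{C}$.
   Context: $\mathbf{H}_d(\mathbb{F})$ is the set of Hermitian (symmetric if $\mathbb{F}=\mathbb{R}$) matrices in $\mathbb{F}^{d\times d}$. A tuple $\mathcal{A}=(A_j)_{j=1}^N\in \mathbf{H}_d(\mathbb{F})^N$ has the almost everywhere phase retrieval property (is PR-ae) on $\mathbb{F}^d$ if for Lebesgue-almost every $x\in\mathbb{F}^d$ the following holds: whenever $y\in\mathbb{F}^d$ satisfies $y^{*}A_jy=x^{*}A_jx$ for all $1\le j\le N$, then $y=cx$ for some $c\in\mathbb{F}$ with $|c|=1$. *)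

(* Defs.v *)
From mathcomp Require Import all_boot all_order all_algebra.
From mathcomp Require Import all_classical all_reals all_analysis.
From mathcomp Require Export sesquilinear complex.
Set Implicit Arguments.
Unset Strict Implicit.
Unset Printing Implicit Defensive.
Import Order.TTheory GRing.Theory Num.Theory.
Local Open Scope classical_set_scope.
Local Open Scope ring_scope.

Definition box (R : realType) (d : nat) (a b : 'cV[R]_d) : set 'cV[R]_d :=
  [set x | forall i, a i 0 <= x i 0 <= b i 0].

(* [box a b] is empty as soon as [b i 0 < a i 0] for some [i]; the maximum
   gives such a box volume 0. *)
Definition box_volume (R : realType) (d : nat) (a b : 'cV[R]_d) : R :=
  \prod_(i < d) Num.max 0 (b i 0 - a i 0).

(* The covering family is indexed by an arbitrary set [P] of naturals, so that
   the empty cover is allowed: in dimension 0 every box has volume 1. *)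
Definition lebesgue_outer (R : realType) (d : nat) (A : set 'cV[R]_d) : \bar R :=
  ereal_inf [set s | exists (P : pred nat) (a b : nat -> 'cV[R]_d),
    A `<=` \bigcup_(k in [set k | P k]) box (a k) (b k) /\
    s = (\sum_(0 <= k <oo | P k) (box_volume (a k) (b k))%:E)%E].

Definition real_null (R : realType) (d : nat) (A : set 'cV[R]_d) : Prop :=
  lebesgue_outer A = 0%E.

(* C^d is identified with R^(2d) through z |-> (Re z, Im z). *)
Definition realify (R : realType) (d : nat) (z : 'cV[R[i]]_d) : 'cV[R]_(d + d) :=
  col_mx (map_mx (@complex.Re R) z) (map_mx (@complex.Im R) z).

Definition complex_null (R : realType) (d : nat) (A : set 'cV[R[i]]_d) : Prop :=
  real_null [set realify z | z in A].

(* x^* A x, where [theta] is the conjugation of F: the identity when F is R,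
   complex conjugation when F is C. *)
Definition qform (F : numFieldType) (theta : F -> F) (d : nat)
    (A : 'M[F]_d) (x : 'cV[F]_d) : F :=
  (map_mx theta x^T *m A *m x) 0 0.

Definition phase_retrieval_at (F : numFieldType) (theta : F -> F) (d N : nat)
    (A : 'I_N -> 'M[F]_d) (x : 'cV[F]_d) : Prop :=
  forall y : 'cV[F]_d,
    (forall j, qform theta (A j) y = qform theta (A j) x) ->
    exists c : F, `|c| = 1 /\ y = c *: x.

Definition real_PR_ae (R : realType) (d N : nat) (A : 'I_N -> 'M[R]_d) : Prop :=
  real_null (~` [set x | phase_retrieval_at idfun A x]).

Definition complex_PR_ae (R : realType) (d N : nat)
    (A : 'I_N -> 'M[R[i]]_d) : Prop :=
  complex_null (~` [set x | phase_retrieval_at (@Num.conj R[i]) A x]).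

(* Main.v *)
Require Import Defs.
From mathcomp Require Import all_boot all_order all_algebra.
From mathcomp Require Import all_classical all_reals all_analysis.
From mathcomp Require Import sesquilinear complex.
From mathcomp Require Import ring lra.
Set Implicit Arguments.
Unset Strict Implicit.
Unset Printing Implicit Defensive.
Import Order.TTheory GRing.Theory Num.Theory.
Import numFieldNormedType.Exports.
Local Open Scope classical_set_scope.
Local Open Scope ring_scope.

(** Too few quadratic measurements leave a continuum of indistinguishable
vectors around almost every point. Over the reals the measurements are
x |-> x B_j x^T with B_j symmetric; over the complex numbers, writing
z = u + i u' identifies C^d with R^(2d), turns every Hermitian form into a
real quadratic form ([qform_complexify]) and multiplication by i into a skew
matrix J ([quarter_turn]). A velocity w at x leaves all measurements
unchanged to first order when x B_j w^T = 0 for all j; in the complex case w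
is also asked to be orthogonal to x J, the direction of the phase orbit of x.
These are N linear conditions on R^d in the real case, N + 1 on R^(2d) in the
complex case, so if the claimed bound fails they always have a nonzero
solution.

The matrix of these conditions depends continuously on x. Where its rank is
maximal it is locally constant, and a solution v0 at one point extends to a
continuous field v of solutions nearby ([kernel_field]). Following v by Euler
steps of length h changes a measurement by O(h^2) in each step, because the
first-order term vanishes, so over a fixed time T the total change is O(h).
A minimum of the total defect over a compact set of possible endpoints is
therefore zero, which gives a point y with exactly the same measurements as
the starting point x0, at distance O(T) from x0, and displaced by at least
c T in the direction v0 ([level_set_escape]).

The starting point x0 can be taken to satisfy phase retrieval, because the
complement of a null set is dense ([real_null_avoid]). Then y = a x0 + b x0 J
with a^2 + b^2 = 1, so 2 (1 - a) |x0|^2 = |y - x0|^2 = O(T^2); as v0 is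
orthogonal to x0 J, the displacement of y along v0 is
(a - 1) <v0, x0> = O(T^2), which is less than c T once T is small
([dim_le_number_of_forms]). *)

(** * Boxes and null sets *)

Lemma overlap_length_split (R : realDomainType) (a b p q t : R) :
  a <= t -> t <= b -> Num.max 0 (Num.min b q - Num.max a p) =
  Num.max 0 (Num.min t q - Num.max a p) + Num.max 0 (Num.min b q - Num.max t p).
Proof.
move=> at_ tb.
have [tp|pt] := ltP t p.
  rewrite (max_r (le_trans at_ (ltW tp))) [X in _ = X + _]max_l ?add0r //.
  by rewrite subr_le0 ge_min (ltW tp).
have [qt|tq] := ltP q t.
  rewrite (min_r (le_trans (ltW qt) tb)) [X in _ = _ + X]max_l ?addr0 //.
  by rewrite subr_le0 ltW.
have tm : t <= Num.min b q by rewrite le_min tb.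
have mt : Num.max a p <= t by rewrite ge_max at_.
move: (Num.min b q) (Num.max a p) tm mt => u w tu wt.
by rewrite !max_r ?subr_ge0 ?(le_trans wt tu) //; ring.
Qed.

Section Boxes.
Context {R : realType} {d : nat}.
Implicit Types (a b p q : 'cV[R]_d) (i : 'I_d).

(** The volume of the intersection of the box from [a] to [b] with the box from
[p] to [q]; with the second box fixed it is exactly additive when the first is
cut, with no null faces to discard. *)
Definition overlap a b p q : R :=
  \prod_(i < d) Num.max 0 (Num.min (b i 0) (q i 0) - Num.max (a i 0) (p i 0)).

Definition set_coord a i (t : R) : 'cV[R]_d :=
  \col_k (if k == i then t else a k 0).

Lemma box_volume_ge0 a b : 0 <= box_volume a b.
Proof. by apply: prodr_ge0 => i _; rewrite le_max lexx. Qed.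

Lemma overlap_ge0 a b p q : 0 <= overlap a b p q.
Proof. by apply: prodr_ge0 => i _; rewrite le_max lexx. Qed.

Lemma overlap_le_volume a b p q : overlap a b p q <= box_volume p q.
Proof.
apply: ler_prod => i _; rewrite le_max lexx /=.
by rewrite /Num.max /Num.min; do ![case: ltP => ?]; lra.
Qed.

Lemma overlap_sub a b p q : (forall i, p i 0 <= a i 0) ->
  (forall i, b i 0 <= q i 0) -> overlap a b p q = box_volume a b.
Proof.
by move=> pa bq; apply: eq_bigr => i _; rewrite (min_l (bq i)) (max_l (pa i)).
Qed.

Lemma overlap_split a b p q i t : a i 0 <= t <= b i 0 ->
  overlap a b p q =
  overlap a (set_coord b i t) p q + overlap (set_coord a i t) b p q.
Proof.
move=> /andP[ait tbi]; rewrite /overlap (bigD1 i) //= [in RHS](bigD1 i) //=.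
rewrite [X in _ = _ + X](bigD1 i) //= !mxE eqxx.
have -> : \prod_(j < d | j != i) Num.max 0
   (Num.min (set_coord b i t j 0) (q j 0) - Num.max (a j 0) (p j 0)) =
   \prod_(j < d | j != i) Num.max 0 (Num.min (b j 0) (q j 0) - Num.max (a j 0) (p j 0)).
  by apply: eq_bigr => j /negPf ji; rewrite mxE ji.
have -> : \prod_(j < d | j != i) Num.max 0
   (Num.min (b j 0) (q j 0) - Num.max (set_coord a i t j 0) (p j 0)) =
   \prod_(j < d | j != i) Num.max 0 (Num.min (b j 0) (q j 0) - Num.max (a j 0) (p j 0)).
  by apply: eq_bigr => j /negPf ji; rewrite mxE ji.
by rewrite -mulrDl (overlap_length_split _ _ ait tbi).
Qed.

Lemma box_volume_split a b i t : a i 0 <= t <= b i 0 ->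
  box_volume a b = box_volume a (set_coord b i t) + box_volume (set_coord a i t) b.
Proof.
move=> ait; have /andP[at_ tb] := ait.
rewrite -(@overlap_sub a b a b) // (overlap_split _ _ ait).
by congr (_ + _); apply: overlap_sub => // j; rewrite mxE; case: eqP => // ->.
Qed.

Variables (P : pred nat) (A B : nat -> 'cV[R]_d).

Definition covered_mass a b : \bar R :=
  (\sum_(0 <= k <oo | P k) (overlap a b (A k) (B k))%:E)%E.

(** The invariant of the bisection argument: the parts of the family
inside the box from [a] to [b], counted with multiplicity, are too small to fill
it. *)
Definition undercovered a b : Prop := (covered_mass a b < (box_volume a b)%:E)%E.

(** Both sides of the defining inequality are additive under cutting, so two
well-covered halves would make a well-covered whole. *)
Lemma undercovered_split a b i t : a i 0 <= t <= b i 0 -> undercovered a b ->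
  undercovered a (set_coord b i t) \/ undercovered (set_coord a i t) b.
Proof.
move=> ait; apply: contraPP => /not_orP[/negP]; rewrite -leNgt => left_full.
move=> /negP; rewrite -leNgt => right_full.
apply/negP; rewrite -leNgt (box_volume_split ait) EFinD.
apply: le_trans (leeD left_full right_full) _.
rewrite -nneseriesD => [|k _ _|k _ _]; rewrite ?lee_fin ?overlap_ge0 //.
rewrite /covered_mass le_eqVlt; apply/orP; left; apply/eqP.
by apply: eq_eseriesr => k _; rewrite -EFinD (overlap_split _ _ ait).
Qed.

(** Cutting at the midpoint of one coordinate after the other; [s] counts the
coordinates treated so far, which is what the induction needs. *)
Lemma undercovered_halve a b s : (forall i, a i 0 <= b i 0) -> undercovered a b ->
  exists a' b', [/\ undercovered a' b',
    forall i, [/\ a i 0 <= a' i 0, a' i 0 <= b' i 0 & b' i 0 <= b i 0] &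
    forall i, b' i 0 - a' i 0 =
      if (i < s)%N then (b i 0 - a i 0) / 2 else b i 0 - a i 0].
Proof.
move=> leab uab; elim: s => [|s [a' [b' [uab' sub' len']]]].
  by exists a, b; split.
have [sd|ds] := ltnP s d; last first.
  exists a', b'; split => // i; rewrite len'.
  by have is_ := leq_trans (ltn_ord i) ds; rewrite is_ leqW.
pose i0 := Ordinal sd; pose t := (a' i0 0 + b' i0 0) / 2.
have [h1 h2 h3] := sub' i0.
have hi0 := len' i0; rewrite ltnn in hi0.
have tab : a' i0 0 <= t <= b' i0 0 by rewrite /t; apply/andP; split; lra.
have ltS i : i != i0 -> (i < s.+1)%N = (i < s)%N.
  by move=> ii0; rewrite ltnS leq_eqVlt (_ : (i == s :> nat) = false) //; apply/negbTE.
have [u|u] := undercovered_split tab uab'.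
- exists a', (set_coord b' i0 t); split=> // i; have [h4 h5 h6] := sub' i; rewrite mxE.
    by case: eqP => [e|//]; subst i; split; move: tab; rewrite /t; lra.
  case: eqP => [->|/eqP ii0]; last by rewrite ltS.
  by rewrite /= ltnSn /t; lra.
- exists (set_coord a' i0 t), b'; split=> // i; have [h4 h5 h6] := sub' i; rewrite mxE.
    by case: eqP => [e|//]; subst i; split; move: tab; rewrite /t; lra.
  case: eqP => [->|/eqP ii0]; last by rewrite ltS.
  by rewrite /= ltnSn /t; lra.
Qed.

Lemma undercovered_shrink a b n : (forall i, a i 0 <= b i 0) -> undercovered a b ->
  exists a' b', [/\ undercovered a' b',
    forall i, [/\ a i 0 <= a' i 0, a' i 0 <= b' i 0 & b' i 0 <= b i 0] &
    forall i, b' i 0 - a' i 0 = (b i 0 - a i 0) / 2 ^+ n].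
Proof.
move=> leab uab; elim: n => [|n [a' [b' [uab' sub' len']]]].
  by exists a, b; split => // i; rewrite expr0 divr1.
have leab' i : a' i 0 <= b' i 0 by case: (sub' i).
have [a2 [b2 [u2 sub2 len2]]] := undercovered_halve d leab' uab'.
exists a2, b2; split => // i.
  by have [] := sub' i; have [] := sub2 i; split; lra.
by rewrite len2 ltn_ord len' exprSr -mulrA invfM.
Qed.

Lemma not_undercovered_in_member a b k : P k -> (forall i, A k i 0 <= a i 0) ->
  (forall i, b i 0 <= B k i 0) -> ~ undercovered a b.
Proof.
move=> Pk Aka bBk; apply/negP; rewrite -leNgt.
have := @nneseries_lim_ge R (fun k => (overlap a b (A k) (B k))%:E) P 0%N k.+1.
move=> /(_ (fun k _ _ => overlap_ge0 _ _ _ _)); apply: le_trans.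
rewrite big_mkcond big_nat_recr //= Pk overlap_sub // leeDr //.
by apply: sume_ge0 => j _; case: ifP => // _; rewrite lee_fin overlap_ge0.
Qed.

(** By compactness, there is a scale below which every small box of [box a b]
lies inside a single box of the family, hence is fully covered; repeated
halving of an undercovered box would produce an undercovered box of that
scale. *)
Lemma interior_cover_full a b : (forall i, a i 0 <= b i 0) ->
  (forall x, box a b x -> exists2 k, P k & forall i, A k i 0 < x i 0 < B k i 0) ->
  ~ undercovered a b.
Proof.
move=> leab cover uab.
have cpt : compact [set v : 'rV[R]_d | forall i, `[a i 0, b i 0]%classic (v 0 i)].
  by apply: (@rV_compact R d (fun i => `[a i 0, b i 0]%classic)) => i; exact: segment_compact.
have /compact_near_coveringP /(_ nat \oo) := cpt.
move=> /(_ (fun n x => exists2 k, P k & forall i,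
   A k i 0 < x 0 i /\ x 0 i + (b i 0 - a i 0) / 2 ^+ n < B k i 0) _) [|n _ nP].
  move=> x xab; have [|k Pk kx] := cover x^T.
    by move=> i; have := xab i; rewrite mxE /= in_itv.
  have near_k : filter_prod (nbhs x) \oo (fun z : 'rV[R]_d * nat => forall i,
      A k i 0 < z.1 0 i /\ z.1 0 i + (b i 0 - a i 0) / 2 ^+ z.2 < B k i 0).
    apply: (@filter_forall _ _ (fun i (z : 'rV[R]_d * nat) =>
      A k i 0 < z.1 0 i /\ z.1 0 i + (b i 0 - a i 0) / 2 ^+ z.2 < B k i 0)
      (filter_prod (nbhs x) \oo) _) => i.
    have := kx i; rewrite mxE => /andP[Akx xBk].
    have c1 : (fun z : 'rV[R]_d * nat => z.1 0 i) @ filter_prod (nbhs x) \oo --> x 0 i.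
      apply: (@cvg_comp _ _ _ fst (fun y : 'rV[R]_d => y 0 i) _ (nbhs x)); first exact: cvg_fst.
      exact: coord_continuous.
    have c2 : (fun z : 'rV[R]_d * nat => z.1 0 i + (b i 0 - a i 0) / 2 ^+ z.2)
        @ filter_prod (nbhs x) \oo --> x 0 i + (b i 0 - a i 0) * 0.
      apply: cvgD => //; apply: cvgMr.
      apply: (@cvg_comp _ _ _ snd (fun n : nat => (2 ^+ n)^-1) _ \oo); first exact: cvg_snd.
      under eq_cvg do rewrite -exprVn.
      by apply: cvg_expr; rewrite ger0_norm ?invf_lt1 ?invr_ge0 // ltr1n.
    rewrite mulr0 addr0 in c2.
    apply: filterI.
      exact: (c1 _ (lt_nbhsr Akx)).
    exact: (c2 _ (lt_nbhsl xBk)).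
  by apply: filterS near_k => z hz; exists k.
have [a' [b' [uab' sub' len']]] := undercovered_shrink n leab uab.
have [|k Pk kx] := nP n (leqnn n) a'^T.
  by move=> i; have [? ? ?] := sub' i; rewrite mxE /= in_itv /=; apply/andP; split; lra.
apply: (@not_undercovered_in_member a' b' k) => // i; have := kx i;
  rewrite mxE -len' => -[? ?]; lra.
Qed.

End Boxes.

Section Null.
Context {R : realType} {d : nat}.
Implicit Types (a b : 'cV[R]_d).

(** The volume of the enlarged box is at most a polynomial in [e] whose value at
0 is the volume of the original box. *)
Lemma box_volume_enlarge a b (eta : R) : 0 < eta -> exists2 e : R, 0 < e &
  box_volume (a - const_mx e) (b + const_mx e) <= box_volume a b + eta.
Proof.
move=> eta0.
pose p : {poly R} := \prod_(i < d) ((Num.max 0 (b i 0 - a i 0))%:P + 'X *+ 2).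
have pE e : p.[e] = \prod_(i < d) (Num.max 0 (b i 0 - a i 0) + e *+ 2).
  by rewrite horner_prod; apply: eq_bigr => i _; rewrite !hornerE.
have p0 : p.[0] = box_volume a b.
  by rewrite pE; apply: eq_bigr => i _; rewrite mul0rn addr0.
have : p.[e] @[e --> 0^'+] --> p.[0].
  by apply: cvg_at_right_filter; exact: continuous_horner.
move=> pcvg; have small : \forall e \near 0^'+, p.[e] < p.[0] + eta.
  by apply: (pcvg [set y | y < p.[0] + eta]); apply: lt_nbhsl; rewrite ltrDl.
have [e [/= pe e0]] := filter_ex (filterI small (nbhs_right_gt 0)).
exists e => //; rewrite -p0; apply/ltW/(le_lt_trans _ pe).
rewrite pE; apply: ler_prod => i _; rewrite le_max lexx /= !mxE.
by rewrite /Num.max; do ![case: ltP => ?]; lra.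
Qed.

(** Otherwise the box has a cover of total volume less than half of its own.
Enlarging the k-th box of that cover at a cost of vol / 2^(k+2) makes its
members cover by their interiors, and still leaves the total volume too
small. *)
Lemma real_null_avoid (A : set 'cV[R]_d) a b : real_null A ->
  (forall i, a i 0 < b i 0) -> exists2 x, box a b x & ~ A x.
Proof.
move=> nullA ltab; apply: contrapT => inA.
have boxA x : box a b x -> A x by move=> bx; apply: contrapT => Ax; apply: inA; exists x.
have vol0 : 0 < box_volume a b.
  by apply: prodr_gt0 => i _; rewrite lt_max subr_gt0 ltab orbT.
have : (lebesgue_outer A < (box_volume a b / 2)%:E)%E.
  by rewrite nullA lte_fin divr_gt0.
move=> /ereal_inf_lt[_ [P [p [q [Acover ->]]]] small].
pose eta k : R := box_volume a b / 2 / (2 ^ k.+1)%:R.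
have eta0 k : 0 < eta k by rewrite !divr_gt0 // ltr0n expn_gt0.
have /choice[e eP] k : exists e, 0 < e /\
    box_volume (p k - const_mx e) (q k + const_mx e) <= box_volume (p k) (q k) + eta k.
  by have [e e0 le_e] := box_volume_enlarge (p k) (q k) (eta0 k); exists e.
pose p' k := p k - const_mx (e k); pose q' k := q k + const_mx (e k).
apply: (@interior_cover_full _ _ P p' q' a b) => [i|x /boxA /Acover[k Pk kx]|].
- exact: ltW.
- exists k => // i; have [ek _] := eP k; rewrite !mxE.
  by have /andP[? ?] := kx i; lra.
rewrite /undercovered [X in (_ < X%:E)%E](splitr (box_volume a b)) EFinD.
apply: (@le_lt_trans _ _ (\sum_(0 <= k <oo | P k)
   ((box_volume (p k) (q k))%:E + (eta k)%:E))%E).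
  apply: lee_nneseries => [k _ _|k _]; rewrite ?lee_fin ?overlap_ge0 //.
  by apply: le_trans (overlap_le_volume _ _ _ _) _; case: (eP k).
apply: le_lt_trans (epsilon_trick _ _ _) _ => [k||].
- by rewrite lee_fin box_volume_ge0.
- by rewrite ltW // divr_gt0.
- by rewrite lteD2rE.
Qed.
End Null.

Section Dense.
Context {R : realType} {n : nat}.

Lemma dense_of_null (A : set 'cV[R]_n) (G : set 'rV[R]_n) : real_null A ->
  (forall x : 'rV[R]_n, ~ A x^T -> G x) ->
  forall (x : 'rV[R]_n) (e : R), 0 < e -> exists2 y, G y & `|y - x| <= e.
Proof.
move=> nullA AG x e e0.
have [|y yx nAy] := @real_null_avoid R n A (x^T - const_mx e) (x^T + const_mx e) nullA.
  by move=> i; rewrite !mxE; lra.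
exists y^T; first by apply: AG; rewrite trmxK.
rewrite [leLHS]/Num.norm /= mx_normrE; apply/bigmax_leP; split; first exact: ltW.
move=> [i j] _ /=; rewrite !mxE (ord1 i).
by have := yx j; rewrite !mxE /= => /andP[? ?]; rewrite ler_norml; apply/andP; split; lra.
Qed.
End Dense.

(** * Kernels of matrices depending continuously on a point *)

Section ContinuousMatrix.
Context {R : realType} {T : topologicalType}.

(** Continuity entry by entry is the form in which sums, products and
determinants can be handled directly. *)
Definition continuous_entries m n (f : T -> 'M[R]_(m, n)) :=
  forall i j, continuous (fun x => f x i j).

Lemma continuous_sum (I : Type) (r : seq I) (P : pred I) (f : I -> T -> R) :
  (forall i, P i -> continuous (f i)) -> continuous (fun x => \sum_(i <- r | P i) f i x).
Proof. by move=> cf; apply: continuous_big => //; exact: add_continuous. Qed.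

Lemma continuous_prod (I : Type) (r : seq I) (P : pred I) (f : I -> T -> R) :
  (forall i, P i -> continuous (f i)) -> continuous (fun x => \prod_(i <- r | P i) f i x).
Proof. by move=> cf; apply: continuous_big => //; exact: mul_continuous. Qed.

Lemma continuous_entries_cst m n (A : 'M[R]_(m, n)) : continuous_entries (fun=> A).
Proof. by move=> i j x; exact: cvg_cst. Qed.

Lemma continuous_entries_mul m n p (f : T -> 'M[R]_(m, n)) (g : T -> 'M[R]_(n, p)) :
  continuous_entries f -> continuous_entries g ->
  continuous_entries (fun x => f x *m g x).
Proof.
move=> cf cg i j.
rewrite [X in continuous X](_ : _ = fun x => \sum_k f x i k * g x k j).
  by apply: continuous_sum => k _ x; apply: continuousM; [exact: cf|exact: cg].
by apply/funext => x; rewrite mxE.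
Qed.

Lemma continuous_entries_scale m n (s : T -> R) (f : T -> 'M[R]_(m, n)) :
  continuous s -> continuous_entries f -> continuous_entries (fun x => s x *: f x).
Proof.
move=> cs cf i j.
rewrite [X in continuous X](_ : _ = fun x => s x * f x i j).
  by move=> x; apply: continuousM; [exact: cs|exact: cf].
by apply/funext => x; rewrite mxE.
Qed.

Lemma continuous_entries_sub m n (f g : T -> 'M[R]_(m, n)) :
  continuous_entries f -> continuous_entries g -> continuous_entries (fun x => f x - g x).
Proof.
move=> cf cg i j.
rewrite [X in continuous X](_ : _ = fun x => f x i j - g x i j).
  by move=> x; apply: continuousB; [exact: cf|exact: cg].
by apply/funext => x; rewrite !mxE.
Qed.

Lemma continuous_det n (f : T -> 'M[R]_n) :
  continuous_entries f -> continuous (fun x => \det (f x)).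
Proof.
move=> cf; apply: continuous_sum => s _ x.
apply: cvgM; first exact: cvg_cst.
by apply: continuous_prod => i _; exact: cf.
Qed.

Lemma continuous_entries_adj n (f : T -> 'M[R]_n) :
  continuous_entries f -> continuous_entries (fun x => \adj (f x)).
Proof.
move=> cf i j.
rewrite [X in continuous X](_ : _ = fun x => (-1) ^+ (j + i) * \det (row' j (col' i (f x)))).
  move=> x; apply: cvgM; first exact: cvg_cst.
  apply: continuous_det => k l.
  rewrite [X in continuous X](_ : _ = fun x => f x (lift j k) (lift i l)); first exact: cf.
  by apply/funext => y; rewrite !mxE.
by apply/funext => x; rewrite mxE.
Qed.

Lemma continuous_entries_cvg m n (f : T -> 'M[R]_(m, n)) (x : T) :
  continuous_entries f -> f y @[y --> x] --> f x.
Proof.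
move=> cf A [P fP PA].
have near_P : nbhs x (fun y => forall i, forall j, P i j (f y i j)).
  apply: (@filter_forall _ _ (fun i y => forall j, P i j (f y i j))) => i.
  apply: (@filter_forall _ _ (fun j y => P i j (f y i j))) => j.
  exact: (cf i j x _ (fP i j)).
by apply: filterS near_P => y Py; exact: PA.
Qed.

Lemma near_unit r (W : T -> 'M[R]_r) x0 : continuous_entries W ->
  W x0 = 1%:M -> \forall x \near x0, W x \in unitmx.
Proof.
move=> cW W0; have det_cvg : \det (W x) @[x --> x0] --> \det (W x0).
  exact: continuous_det.
have near_det : \forall x \near x0, \det (W x) != 0.
  apply: (det_cvg [set y | y != 0]); rewrite W0 det1.
  by apply: open_nbhs_nbhs; split; [exact: open_neq|exact: oner_neq0].
by apply: filterS near_det => x detW; rewrite unitmxE unitfE.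
Qed.

Lemma continuous_entries_sandwich p m n q (Q : 'M[R]_(p, m)) (M : T -> 'M[R]_(m, n))
    (P : 'M[R]_(n, q)) :
  continuous_entries M -> continuous_entries (fun x => Q *m M x *m P).
Proof.
move=> cM; apply: (continuous_entries_mul _ (@continuous_entries_cst _ _ P)).
exact: (continuous_entries_mul (@continuous_entries_cst _ _ Q) cM).
Qed.

(** The two outer factors are one-sided inverses of a rank factorization of
[A]. *)
Lemma rank_compression m n (A : 'M[R]_(m, n)) :
  exists Q P, Q *m A *m P = 1%:M :> 'M[R]_(\rank A).
Proof.
exists (pinvmx (col_base A)), (pinvmx (row_base A)).
have assoc a b c e f (Q : 'M[R]_(a, b)) (C : 'M[R]_(b, c)) (D : 'M[R]_(c, e)) (P : 'M[R]_(e, f)) :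
  Q *m (C *m D) *m P = Q *m C *m (D *m P) by rewrite !mulmxA.
rewrite -[X in _ *m X *m _]mulmx_base assoc (mulVpmx (col_base_full _)).
by rewrite mul1mx mulmxVp // row_base_free.
Qed.

(** Lower semicontinuity of the rank: an invertible compression of [M x0] stays
invertible nearby. *)
Lemma near_rank_ge m n (M : T -> 'M[R]_(m, n)) x0 :
  continuous_entries M -> \forall x \near x0, (\rank (M x0) <= \rank (M x))%N.
Proof.
move=> cM; have [Q [P W0]] := rank_compression (M x0).
have := near_unit (continuous_entries_sandwich (Q := Q) (P := P) cM) W0.
apply: filterS => x /mxrank_unit rkW; rewrite -[X in (X <= _)%N]rkW.
by apply: leq_trans (mxrankM_maxl _ _) (mxrankM_maxr _ _).
Qed.

(** With W = Q M P invertible near x0, the vector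
det W v0 - v0 M P adj(W) Q is annihilated by M P, by the adjugate identity.
As the rank of [M] is maximal at [x0], M and M P have the same left kernel
near x0. *)
Lemma kernel_field m n (M : T -> 'M[R]_(m, n)) x0 (v0 : 'rV[R]_m) :
  continuous_entries M -> (forall x, (\rank (M x) <= \rank (M x0))%N) ->
  v0 *m M x0 = 0 -> exists v : T -> 'rV[R]_m,
  [/\ continuous_entries v, v x0 = v0 & \forall x \near x0, v x *m M x = 0].
Proof.
move=> cM rk_max v0M; have [Q [P W0]] := rank_compression (M x0).
pose W x := Q *m M x *m P; have cW := continuous_entries_sandwich (Q := Q) (P := P) cM.
exists (fun x => \det (W x) *: v0 - v0 *m M x *m P *m \adj (W x) *m Q); split.
- apply: continuous_entries_sub.
    apply: (continuous_entries_scale _ (@continuous_entries_cst _ _ v0)).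
    exact: continuous_det.
  apply: (continuous_entries_mul _ (@continuous_entries_cst _ _ Q)).
  apply: (continuous_entries_mul _ (continuous_entries_adj cW)).
  exact: continuous_entries_sandwich.
- by rewrite /W W0 det1 scale1r v0M !mul0mx subr0.
apply: filterS (near_unit cW W0) => x unitW.
have rk_MP : (\rank (M x) <= \rank (M x *m P))%N.
  apply: leq_trans (rk_max x) _; rewrite -[X in (X <= _)%N](mxrank_unit unitW) -mulmxA.
  exact: mxrankM_maxr.
have /eqmxP ker_eq : (kermx (M x) == kermx (M x *m P))%MS.
  rewrite -(geq_leqif (mxrank_leqif_eq _)) ?mxrank_ker ?leq_sub2l //.
  by apply/sub_kermxP; rewrite mulmxA mulmx_ker mul0mx.
apply/sub_kermxP; rewrite ker_eq; apply/sub_kermxP.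
have -> : (\det (W x) *: v0 - v0 *m M x *m P *m \adj (W x) *m Q) *m (M x *m P) =
    \det (W x) *: (v0 *m M x *m P) - v0 *m M x *m P *m (\adj (W x) *m W x).
  by rewrite mulmxBl -scalemxAl /W !mulmxA.
by rewrite mul_adj_mx mul_mx_scalar subrr.
Qed.
End ContinuousMatrix.

(** * Euler polygons in level sets of quadratic forms *)

Section Forms.
Context {R : realType} {n : nat}.
Implicit Types (B : 'M[R]_n) (x y u w : 'rV[R]_n).

Definition bform B x y : R := (x *m B *m y^T) 0 0.
Definition dot x y : R := (x *m y^T) 0 0.

Lemma dotE x y : dot x y = bform 1%:M x y.
Proof. by rewrite /bform mulmx1. Qed.

Lemma bformDl B x y w : bform B (x + y) w = bform B x w + bform B y w.
Proof. by rewrite /bform !mulmxDl mxE. Qed.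

Lemma bformDr B x y w : bform B x (y + w) = bform B x y + bform B x w.
Proof. by rewrite /bform linearD mulmxDr mxE. Qed.

Lemma bformZl B (t : R) x y : bform B (t *: x) y = t * bform B x y.
Proof. by rewrite /bform -!scalemxAl mxE. Qed.

Lemma bformZr B (t : R) x y : bform B x (t *: y) = t * bform B x y.
Proof. by rewrite /bform linearZ -scalemxAr mxE. Qed.

Lemma bformC B x y : B^T = B -> bform B x y = bform B y x.
Proof.
move=> symB; rewrite /bform.
have -> : x *m B *m y^T = (y *m B *m x^T)^T.
  by rewrite !trmx_mul trmxK symB mulmxA.
by rewrite mxE.
Qed.

(** For a quadratic form the Taylor expansion stops at order 2, so a step in a
tangent direction has an exact error. *)
Lemma bform_quad_step B x w (h : R) : B^T = B -> bform B x w = 0 ->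
  bform B (x + h *: w) (x + h *: w) = bform B x x + h ^+ 2 * bform B w w.
Proof.
move=> symB tangent; rewrite bformDl !bformDr !bformZl !bformZr (bformC w x symB) tangent.
by ring.
Qed.

Lemma entry_le_norm x i : `|x 0 i| <= `|x|.
Proof.
rewrite [leRHS]/Num.norm /= mx_normrE; apply/bigmax_geP; right => /=.
by exists (0, i).
Qed.

Lemma bform_le B : exists2 K : R, 0 <= K &
  forall x y, `|bform B x y| <= K * `|x| * `|y|.
Proof.
exists (\sum_i \sum_j `|B j i|); first by do 2![apply: sumr_ge0 => ? _].
move=> x y; rewrite /bform mxE mulr_suml mulr_suml.
apply: le_trans (ler_norm_sum _ _ _) _; apply: ler_sum => i _.
rewrite !mxE normrM ler_pM ?entry_le_norm //.
apply: le_trans (ler_norm_sum _ _ _) _; rewrite mulr_suml; apply: ler_sum => j _.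
by rewrite normrM mulrC ler_wpM2l ?entry_le_norm.
Qed.

Lemma continuous_bform (T : topologicalType) B (f g : T -> 'rV[R]_n) :
  continuous_entries f -> continuous_entries g ->
  continuous (fun t => bform B (f t) (g t)).
Proof.
move=> cf cg.
have cgT : continuous_entries (fun t => (g t)^T).
  move=> i j; rewrite (_ : (fun t => (g t)^T i j) = fun t => g t j i) //.
  by apply/funext => t; rewrite mxE.
have cB : continuous_entries (fun _ : T => B) by exact: continuous_entries_cst.
have cfBg := continuous_entries_mul (continuous_entries_mul cf cB) cgT.
have := cfBg 0 0; exact.
Qed.

End Forms.

Section EulerPolygon.
Context {R : realType} {n N : nat}.
Variables (B : 'I_N -> 'M[R]_n) (x0 v0 : 'rV[R]_n) (v : 'rV[R]_n -> 'rV[R]_n).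
Variables (r c C : R).
Hypothesis C0 : 0 <= C.
Hypothesis symB : forall j, (B j)^T = B j.
Hypothesis v_tangent : forall (x : 'rV[R]_n) j, `|x - x0| <= r -> bform (B j) x (v x) = 0.
Hypothesis v_bounded : forall x : 'rV[R]_n, `|x - x0| <= r -> `|v x| <= C.
Hypothesis v_forward : forall x : 'rV[R]_n, `|x - x0| <= r -> c <= dot v0 (v x).

(** The last clause quantifies over every bound [K] of the form, so that one
polygon can be used with bounds chosen independently of it. *)
Lemma euler_polygon (h : R) k : 0 <= h -> k%:R * (h * C) <= r ->
  exists x, [/\ `|x - x0| <= k%:R * (h * C),
    k%:R * (h * c) <= dot v0 (x - x0) &
    forall j K, (forall u w, `|bform (B j) u w| <= K * `|u| * `|w|) -> 0 <= K ->
      `|bform (B j) x x - bform (B j) x0 x0| <= k%:R * (h ^+ 2 * (K * C * C))].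
Proof.
move=> h0; elim: k => [|k IHk] hr.
  exists x0; rewrite !subrr !mul0r !normr0 lexx; split=> // [|j K _ _].
    by rewrite /dot trmx0 mulmx0 mxE.
  by rewrite subrr normr0 mul0r.
have hC0 : 0 <= h * C by rewrite mulr_ge0.
have kr : k%:R * (h * C) <= r by apply: le_trans hr; rewrite ler_wpM2r // ler_nat.
have [x [xC xc xB]] := IHk kr.
have xr : `|x - x0| <= r := le_trans xC kr.
have Sk (t : R) : k.+1%:R * t = k%:R * t + t by rewrite -natr1 mulrDl mul1r.
exists (x + h *: v x); split => [||j K BK K0].
- rewrite addrAC Sk; apply: le_trans (ler_normD _ _) (lerD xC _).
  by rewrite normrZ ger0_norm // ler_wpM2l // v_bounded.
- rewrite addrAC Sk dotE bformDr bformZr -!dotE.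
  by apply: lerD => //; rewrite ler_wpM2l // v_forward.
- rewrite (bform_quad_step h (symB j) (v_tangent j xr)) addrAC Sk.
  apply: le_trans (ler_normD _ _) (lerD (xB j K BK K0) _).
  rewrite normrM ger0_norm ?sqr_ge0 // ler_wpM2l ?sqr_ge0 //.
  apply: le_trans (BK _ _) _; have vC := v_bounded xr.
  by rewrite !ler_pM // !mulr_ge0.
Qed.

(** The end points of the Euler polygons of total time [T] all lie in one
compact set, on which the total defect attains its minimum; k steps give a
defect O(1/k), so that minimum is 0. *)
Lemma level_set_escape (T : R) : 0 <= T -> T * C <= r ->
  exists y, [/\ `|y - x0| <= T * C, T * c <= dot v0 (y - x0) &
    forall j, bform (B j) y y = bform (B j) x0 x0].
Proof.
move=> T0 TCr.
pose S := [set y : 'rV[R]_n | `|y - x0| <= T * C /\ T * c <= dot v0 (y - x0)].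
pose defect (y : 'rV[R]_n) : R := \sum_j `|bform (B j) y y - bform (B j) x0 x0|.
have cont_id : continuous_entries (fun y : 'rV[R]_n => y).
  by move=> i j; exact: coord_continuous.
have cont_shift : continuous_entries (fun y : 'rV[R]_n => y - x0).
  exact: (continuous_entries_sub cont_id (@continuous_entries_cst _ _ _ _ x0)).
have cont_v0 : continuous_entries (fun _ : 'rV[R]_n => v0) by exact: continuous_entries_cst.
have polygon (k : nat) : exists2 y, S y & forall j K,
    (forall u w, `|bform (B j) u w| <= K * `|u| * `|w|) -> 0 <= K ->
    `|bform (B j) y y - bform (B j) x0 x0| <= T ^+ 2 * (K * C * C) / k.+1%:R.
  have kE (t : R) : k.+1%:R * (T / k.+1%:R * t) = T * t.
    by rewrite mulrA mulrCA divff ?mulr1 // pnatr_eq0.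
  have [||y [yC yc yB]] := @euler_polygon (T / k.+1%:R) k.+1.
  - by rewrite divr_ge0.
  - by rewrite kE.
  rewrite !kE in yC yc; exists y => // j K BK K0.
  apply: le_trans (yB j K BK K0) _.
  have : k.+1%:R != 0 :> R by rewrite pnatr_eq0.
  move: (k.+1%:R) => s s0; rewrite le_eqVlt; apply/orP; left; apply/eqP.
  by field.
have cont_norm : continuous (fun y : 'rV[R]_n => `|y - x0|).
  move=> y; apply: (@cvg_norm R 'rV[R]_n 'rV[R]_n (nbhs y) _ (fun y => y - x0) (y - x0)).
  by have := continuous_entries_cvg (x := y) cont_shift; exact.
have cont_dot : continuous (fun y : 'rV[R]_n => dot v0 (y - x0)).
  rewrite (_ : (fun y : 'rV[R]_n => _) = fun y : 'rV[R]_n => bform 1%:M v0 (y - x0)).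
    exact: continuous_bform.
  by apply/funext => z; rewrite dotE.
have cont_defect j :
    continuous (fun y : 'rV[R]_n => `|bform (B j) y y - bform (B j) x0 x0|).
  have cont_q : continuous (fun y : 'rV[R]_n => bform (B j) y y) by exact: continuous_bform.
  have cont_diff : continuous (fun y : 'rV[R]_n => bform (B j) y y - bform (B j) x0 x0).
    move=> y; have := @continuousB R R^o _ (fun y : 'rV[R]_n => bform (B j) y y)
      (fun=> bform (B j) x0 x0) y (cont_q y).
    by apply; exact: cst_continuous.
  move=> y; have := continuous_comp (cont_diff y) (@norm_continuous R R _); exact.
have S0 : S !=set0 by have [y Sy _] := polygon 0%N; exists y.
have Scpt : compact S.
  apply: bounded_closed_compact.
    exists (`|x0| + T * C); split; first exact: num_real.
    move=> M ltM y [yC _]; apply: le_trans (ltW ltM).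
    by rewrite -[y](subrK x0) addrC (le_trans (ler_normD _ _)) // lerD.
  apply: closedI.
    by apply: (closed_comp (D := [set t | t <= T * C])) => [y _|];
      [exact: cont_norm|exact: closed_le].
  by apply: (closed_comp (D := [set t | T * c <= t])) => [y _|];
    [exact: cont_dot|exact: closed_ge].
have [|y yS ymin] := compact_EVT_min (f := defect) S0 Scpt.
  by apply: continuous_subspaceT; apply: continuous_sum => j _; exact: cont_defect.
move: yS; rewrite inE => -[yC yc].
exists y; split => //.
have [K K0 BK] : exists2 K : 'I_N -> R, forall j, 0 <= K j & forall j u w,
    `|bform (B j) u w| <= K j * `|u| * `|w|.
  have /choice[K KP] j : exists K, 0 <= K /\ forall u w, `|bform (B j) u w| <= K * `|u| * `|w|.
    by have [K K0 BK] := bform_le (B j); exists K.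
  by exists K => j; case: (KP j).
pose D := \sum_j T ^+ 2 * (K j * C * C).
have defect_le k : defect y <= D / k.+1%:R.
  have [z Sz zB] := polygon k.
  apply: le_trans (ymin z _) _; first by rewrite inE.
  by rewrite mulr_suml; apply: ler_sum => j _; apply: zB.
have defect0 : defect y <= 0.
  apply/ler_addgt0Pr => e e0; rewrite add0r.
  have /(_ [set t | t < e]) : D / k.+1%:R @[k --> \oo] --> (D * 0).
    by apply: cvgMr; exact: cvg_harmonic.
  rewrite mulr0 => /(_ (lt_nbhsl e0)) near_e.
  have {}near_e : \forall k \near \oo, D / k.+1%:R < e by exact: near_e.
  have [k ke] := filter_ex near_e.
  by apply: le_trans (defect_le k) _; rewrite ltW.
move=> j; apply/eqP; rewrite -subr_eq0 -normr_le0; apply: le_trans defect0.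
by rewrite /defect (bigD1 j) //= lerDl sumr_ge0.
Qed.

End EulerPolygon.

(** * Phase orbits are too small when there are few forms *)

Section Core.
Context {R : realType} {n : nat}.
Implicit Types (x y w : 'rV[R]_n).

Lemma dot_ge0 x : 0 <= dot x x.
Proof. by rewrite /dot mxE sumr_ge0 // => i _; rewrite mxE -expr2 sqr_ge0. Qed.

Lemma dot_eq0 x : dot x x = 0 -> x = 0.
Proof.
rewrite /dot mxE => /eqP; rewrite psumr_eq0; last first.
  by move=> i _; rewrite mxE -expr2 sqr_ge0.
move=> /allP x0; apply/rowP => i; have := x0 i (mem_index_enum i).
by rewrite !mxE /= mulf_eq0 orbb => /eqP.
Qed.

Lemma max_rank_point m (M : 'rV[R]_n -> 'M[R]_(n, m)) :
  exists x0, forall x, (\rank (M x) <= \rank (M x0))%N.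
Proof.
pose P k := `[< exists x, \rank (M x) = k >].
have exP : exists k, P k by exists (\rank (M 0)); apply/asboolP; exists 0.
have ubP k : P k -> (k <= n)%N by move=> /asboolP[x <-]; exact: rank_leq_row.
have /asboolP[x0 x0max] : P (ex_maxn exP ubP) by case: ex_maxnP.
exists x0 => x; rewrite x0max; case: ex_maxnP => k _; apply.
by apply/asboolP; exists x.
Qed.

(** Near a point where the matrix M of the linear forms w |-> x (C k) w^T has
maximal rank, all points have maximal rank, so a point of the dense set [G]
can be used as the starting point. With fewer forms than dimensions there is
a nonzero [v0] in the kernel there. *)
Lemma escape_from_good_point N (B : 'I_N -> 'M[R]_n) m (C : 'I_m -> 'M[R]_n)
    (G : set 'rV[R]_n) :
  (forall j, (B j)^T = B j) -> (m < n)%N ->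
  (forall j x w, (forall k, bform (C k) x w = 0) -> bform (B j) x w = 0) ->
  (forall x e, 0 < e -> exists2 y, G y & `|y - x| <= e) ->
  exists x0 v0 c D r, [/\ G x0, forall k, bform (C k) x0 v0 = 0, 0 < c, 0 < D & 0 < r /\
    forall T, 0 <= T -> T <= r -> exists y, [/\ `|y - x0| <= T * D,
      T * c <= dot v0 (y - x0) & forall j, bform (B j) y y = bform (B j) x0 x0]].
Proof.
move=> symB mn CB denseG.
pose M x : 'M[R]_(n, m) := \matrix_(i, k) (x *m C k) 0 i.
have ME x w k : (w *m M x) 0 k = bform (C k) x w.
  by rewrite /bform !mxE; apply: eq_bigr => i _; rewrite !mxE mulrC.
have cM : continuous_entries M.
  have cid : continuous_entries (fun x : 'rV[R]_n => x).
    by move=> i j; exact: coord_continuous.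
  move=> i k.
  have cxC := continuous_entries_mul cid (@continuous_entries_cst _ _ _ _ (C k)).
  rewrite (_ : (fun x => M x i k) = fun x => (x *m C k) 0 i); first exact: (cxC 0 i).
  by apply/funext => x; rewrite mxE.
have [x1 x1max] := max_rank_point M.
have near_max : \forall x \near x1, (\rank (M x1) <= \rank (M x))%N.
  exact: near_rank_ge.
have /nbhs_normP[e /= e0 e_rank] := near_max.
have [x0 Gx0 x01] := denseG x1 (e / 2) (divr_gt0 e0 (ltr0Sn _ 1)).
have x0max x : (\rank (M x) <= \rank (M x0))%N.
  apply: leq_trans (x1max x) (e_rank _ _); rewrite /= distrC.
  by apply: le_lt_trans x01 _; rewrite ltr_pdivrMr // ltr_pMr // ltr1n.
have : kermx (M x0) != 0.
  rewrite -mxrank_eq0 mxrank_ker -lt0n subn_gt0.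
  by apply: leq_ltn_trans mn; exact: rank_leq_col.
move=> /rowV0Pn[v0 /sub_kermxP v0M v0_neq0].
have v00 : 0 < dot v0 v0.
  rewrite lt_neqAle dot_ge0 andbT eq_sym; apply: contra_neq v0_neq0; exact: dot_eq0.
have [v [cv vx0 vM]] := kernel_field cM x0max v0M.
have near_fwd : \forall x \near x0, dot v0 v0 / 2 < dot v0 (v x).
  have cdot : continuous (fun x => dot v0 (v x)).
    rewrite (_ : (fun x => dot v0 (v x)) = fun x => bform 1%:M v0 (v x)).
      by apply: continuous_bform => //; exact: continuous_entries_cst.
    by apply/funext => x; rewrite dotE.
  apply: (cdot x0 [set t | dot v0 v0 / 2 < t]); apply: lt_nbhsr.
  by rewrite vx0 ltr_pdivrMr // ltr_pMr // ltr1n.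
have near_bnd : \forall x \near x0, `|v x| < `|v0| + 1.
  have near_v : v x @[x --> x0] --> v x0 by exact: continuous_entries_cvg.
  have : nbhs (v x0) [set u | `|u| < `|v0| + 1].
    apply: (@norm_continuous _ _ (v x0) [set t | t < `|v0| + 1]).
    by apply: lt_nbhsl; rewrite vx0 ltrDl.
  exact: near_v.
have near_all : \forall x \near x0, v x *m M x = 0 /\
    dot v0 v0 / 2 < dot v0 (v x) /\ `|v x| < `|v0| + 1.
  by apply: filterI vM _; exact: filterI near_fwd near_bnd.
have /nbhs_normP[r /= r0 r_near] := near_all.
have in_r x : `|x - x0| <= r / 2 -> v x *m M x = 0 /\
    dot v0 v0 / 2 < dot v0 (v x) /\ `|v x| < `|v0| + 1.
  move=> xr; apply: r_near; rewrite /= distrC.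
  by apply: le_lt_trans xr _; rewrite ltr_pdivrMr // ltr_pMr // ltr1n.
have D0 : 0 < `|v0| + 1 by rewrite ltr_wpDl.
exists x0, v0, (dot v0 v0 / 2), (`|v0| + 1), (r / 2 / (`|v0| + 1)).
split => //; first by move=> k; rewrite -ME v0M mxE.
  by rewrite divr_gt0.
split; first by rewrite !divr_gt0.
move=> T T0 Tr.
apply: (@level_set_escape _ _ _ B x0 v0 v (r / 2)) => //.
- by move=> x j /in_r[xM _]; apply: CB => k; rewrite -ME xM mxE.
- by move=> x /in_r[_ [_ /ltW]].
- by move=> x /in_r[_ [/ltW]].
- by rewrite -ler_pdivlMr.
Qed.

(** The hypothesis on [G] describes phase orbits: the points with the measurements
of a good x lie on the orbit of x under the rotations a + b J. Along such an
orbit the displacement orthogonal to x J is quadratic in the distance, whereas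
[escape_from_good_point] provides a linear one. *)
Lemma dim_le_number_of_forms N (B : 'I_N -> 'M[R]_n) (J : 'M[R]_n) m (C : 'I_m -> 'M[R]_n)
    (G : set 'rV[R]_n) :
  (forall j, (B j)^T = B j) ->
  (forall x w, (forall k, bform (C k) x w = 0) ->
    (forall j, bform (B j) x w = 0) /\ bform J x w = 0) ->
  (forall x e, 0 < e -> exists2 y, G y & `|y - x| <= e) ->
  (forall x y, G x -> (forall j, bform (B j) y y = bform (B j) x x) ->
    exists a b, y = a *: x + b *: (x *m J) /\
      dot (y - x) (y - x) = 2 * (1 - a) * dot x x) ->
  (n <= m)%N.
Proof.
move=> symB CBJ denseG goodG; rewrite leqNgt; apply/negP => mn.
have CB j x w : (forall k, bform (C k) x w = 0) -> bform (B j) x w = 0.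
  by move=> /CBJ[].
have [x0 [v0 [c [D [r [Gx0 Cv0 c0 D0 [r0 esc]]]]]]] :=
  escape_from_good_point symB mn CB denseG.
have [_ Jv0] := CBJ _ _ Cv0.
have [K K0 K_le] := bform_le (1%:M : 'M[R]_n).
pose s := dot v0 x0; pose X := dot x0 x0; pose kappa := K * D * D * `|s|.
have kappa0 : 0 <= kappa by rewrite !mulr_ge0 // ltW.
have key T : 0 < T -> T <= r -> 0 < X /\ 2 * c * X <= T * kappa.
  move=> T0 Tr; have [y [yD yc yB]] := esc T (ltW T0) Tr.
  have [a [b [ya yX]]] := goodG _ _ Gx0 yB.
  have dot_y : dot v0 (y - x0) = (a - 1) * s.
    rewrite dotE ya addrAC -[X in _ - X]scale1r -scalerBl bformDr !bformZr -!dotE.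
    have -> : dot v0 (x0 *m J) = bform J x0 v0.
      by rewrite dotE bformC ?trmx1 // /bform mulmx1.
    by rewrite Jv0 mulr0 addr0.
  rewrite dot_y in yc.
  have q_le : dot (y - x0) (y - x0) <= K * (T * D) * (T * D).
    rewrite dotE; apply: le_trans (ler_norm _) _; apply: le_trans (K_le _ _) _.
    by rewrite -!(mulrA K) ler_wpM2l // ler_pM.
  rewrite yX -/X in q_le.
  have X0 : 0 < X.
    rewrite lt_neqAle dot_ge0 andbT; apply/eqP => /esym /dot_eq0 x00.
    move: yc; rewrite /s x00 /dot trmx0 mulmx0 mxE mulr0.
    by apply/negP; rewrite -ltNge mulr_gt0.
  split => //; rewrite -(ler_pM2l T0).
  have -> : T * (2 * c * X) = 2 * X * (T * c) by ring.
  apply: (@le_trans _ _ (2 * X * ((a - 1) * s))).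
    by rewrite ler_wpM2l // mulr_ge0 // ltW.
  have q0 : 0 <= 2 * (1 - a) * X by rewrite -yX dot_ge0.
  have -> : 2 * X * ((a - 1) * s) = 2 * (1 - a) * X * (- s) by ring.
  apply: (@le_trans _ _ (2 * (1 - a) * X * `|s|)).
    by rewrite ler_wpM2l // -normrN ler_norm.
  have -> : T * (T * kappa) = K * (T * D) * (T * D) * `|s| by rewrite /kappa; ring.
  by rewrite ler_wpM2r.
have [X0 _] := key r r0 (lexx r).
(* With this time, T * kappa <= c X, against the bound 2 c X <= T * kappa. *)
pose T := Num.min r (c * X / (kappa + 1)).
have k1 : 0 < kappa + 1 by rewrite ltr_wpDl.
have T0 : 0 < T by rewrite lt_min r0 divr_gt0 // mulr_gt0.
have Tr : T <= r by rewrite ge_min lexx.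
have Tk : T * (kappa + 1) <= c * X by rewrite -ler_pdivlMr // ge_min lexx orbT.
have [_ cXT] := key T T0 Tr.
have cX : 0 < c * X by rewrite mulr_gt0.
by move: Tk cXT; rewrite mulrDr mulr1 -mulrA => Tk cXT; lra.
Qed.
End Core.

(** * Phase retrieval over the reals *)

(** The phase orbit of x is {x, - x}: the rotations have b = 0, so J = 0 will
do. *)
Lemma real_PR_ae_dim (R : realType) (d N : nat) (A : 'I_N -> 'M[R]_d) :
  (forall j, A j \is symmetricmx) -> real_PR_ae A -> (d <= N)%N.
Proof.
move=> symA PR.
have symB j : (A j)^T = A j.
  by have /is_hermitianmxP := symA j; rewrite expr0 scale1r map_mx_id // => <-.
have qE j (x : 'rV[R]_d) : qform idfun (A j) x^T = bform (A j) x x.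
  by rewrite /qform /bform map_mx_id // trmxK.
pose G := [set x : 'rV[R]_d | phase_retrieval_at idfun A x^T].
apply: (@dim_le_number_of_forms R d N A 0 N A G) => //.
- by move=> x w h; split=> //; rewrite /bform mulmx0 mul0mx mxE.
- by apply: (dense_of_null PR) => x /contrapT.
move=> x y Gx yx; have [j|c [c1 yE]] := Gx y^T; first by rewrite !qE.
have {}yE : y = c *: x by rewrite -[y]trmxK yE linearZ /= trmxK.
have c2 : c ^+ 2 = 1 by rewrite -[LHS]real_normK ?num_real // c1 expr1n.
exists c, 0; rewrite scale0r addr0; split => //.
rewrite yE -[X in _ - X]scale1r -scalerBl !dotE bformZl bformZr mulrA.
congr (_ * _); have -> : (c - 1) * (c - 1) = c ^+ 2 - 2 * c + 1 by ring.
by rewrite c2; ring.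
Qed.

(** * Phase retrieval over the complex numbers *)

Section Complex.
Context {R : realType} {d : nat}.
Implicit Types (x y : 'rV[R]_(d + d)) (A : 'M[R[i]]_d).

Definition complexify x : 'cV[R[i]]_d :=
  \col_i Complex (x 0 (lshift d i)) (x 0 (rshift d i)).

Lemma complexifyK x : realify (complexify x) = x^T.
Proof.
apply/matrixP => i j; rewrite (ord1 j) !mxE.
by case: splitP => k ik; rewrite !mxE /=; congr (x 0 _); apply: val_inj.
Qed.

(** The matrix of z |-> Re (z^* A z) in the coordinates (Re z, Im z). *)
Definition real_form A : 'M[R]_(d + d) :=
  let S := map_mx (@complex.Re R) A in let K := map_mx (@complex.Im R) A in
  block_mx S (- K) K S.

(** Multiplication by i, acting on row vectors from the right. *)
Definition quarter_turn : 'M[R]_(d + d) := block_mx 0 1%:M (- 1%:M) 0.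

Lemma hermitian_parts A : A \is hermsymmx ->
  (map_mx (@complex.Re R) A)^T = map_mx (@complex.Re R) A /\
  (map_mx (@complex.Im R) A)^T = - map_mx (@complex.Im R) A.
Proof.
move=> /is_hermitianmxP; rewrite expr0 scale1r => hA.
have AE i j : A i j = conjc (A j i) by rewrite {1}hA !mxE.
by split; apply/matrixP => i j; rewrite !mxE AE; case: (A i j).
Qed.

Lemma real_form_sym A : A \is hermsymmx -> (real_form A)^T = real_form A.
Proof.
move=> /hermitian_parts[SE KE].
by rewrite /real_form tr_block_mx SE linearN /= KE opprK.
Qed.

Lemma quarter_turnE x i :
  (x *m quarter_turn) 0 (lshift d i) = - x 0 (rshift d i) /\
  (x *m quarter_turn) 0 (rshift d i) = x 0 (lshift d i).
Proof.
rewrite -[x in x *m _]hsubmxK mul_row_block !mulmx0 !mulmx1 add0r addr0 mulmxN mulmx1.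
by rewrite row_mxEl row_mxEr !mxE.
Qed.

Lemma quarter_turn_tr : quarter_turn^T = - quarter_turn.
Proof. by rewrite /quarter_turn tr_block_mx opp_block_mx !linear0 linearN /= trmx1 opprK. Qed.

Lemma quarter_turn_sqr : quarter_turn *m quarter_turn = - 1%:M.
Proof.
rewrite /quarter_turn mulmx_block !mul0mx !mulmx0 !mulmxN !mulNmx !mulmx1.
by rewrite add0r !addr0 scalar_mx_block opp_block_mx oppr0.
Qed.

(** J is skew and orthogonal, so the displacement has squared length
((a - 1)^2 + b^2) |x|^2. *)
Lemma rotation_dist x (a b : R) : a ^+ 2 + b ^+ 2 = 1 ->
  let y := a *: x + b *: (x *m quarter_turn) in
  dot (y - x) (y - x) = 2 * (1 - a) * dot x x.
Proof.
move=> ab y.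
have xJ : dot x (x *m quarter_turn) = 0.
  have : dot x (x *m quarter_turn) = - dot (x *m quarter_turn) x.
    by rewrite /dot trmx_mul quarter_turn_tr mulNmx mulmxN mxE mulmxA.
  rewrite [in X in _ = X](_ : dot (x *m quarter_turn) x = dot x (x *m quarter_turn)).
    by move=> h; lra.
  by rewrite !dotE bformC // trmx1.
have JJ : dot (x *m quarter_turn) (x *m quarter_turn) = dot x x.
  rewrite /dot trmx_mul quarter_turn_tr mulmxA -(mulmxA x) mulmxN quarter_turn_sqr opprK.
  by rewrite mulmx1.
have -> : y - x = (a - 1) *: x + b *: (x *m quarter_turn).
  by rewrite /y addrAC scalerBl scale1r.
rewrite dotE bformDl !bformDr !bformZl !bformZr -!dotE JJ xJ.
have -> : dot (x *m quarter_turn) x = 0 by rewrite dotE bformC ?trmx1 // -dotE.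
have -> : b * (b * dot x x) = b ^+ 2 * dot x x by ring.
have -> : b ^+ 2 = 1 - a ^+ 2 by rewrite -ab; ring.
by ring.
Qed.

Lemma complexify_scale (c : R[i]) x y : complexify y = c *: complexify x ->
  y = complex.Re c *: x + complex.Im c *: (x *m quarter_turn).
Proof.
move=> yx; have := quarter_turnE x; move: (x *m quarter_turn) => z zE.
apply/rowP => k; rewrite -[k]splitK; case: (fintype.split k) => i /=; have [zl zr] := zE i.
- have := congr1 (fun z : 'cV[R[i]]_d => complex.Re (z i 0)) yx.
  by rewrite !mxE zl; case: c {yx} => a b /= ->; ring.
- have := congr1 (fun z : 'cV[R[i]]_d => complex.Im (z i 0)) yx.
  by rewrite !mxE zr; case: c {yx} => a b /= ->; ring.
Qed.

Lemma mulmx_sandwich_expand (K : comNzRingType) (j : K) (u u' : 'rV[K]_d) (S Q : 'M[K]_d)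
    (w w' : 'cV[K]_d) :
  (u - j *: u') *m (S + j *: Q) *m (w + j *: w') =
  u *m S *m w + j *: (u *m S *m w' + u *m Q *m w - u' *m S *m w)
  + j ^+ 2 *: (u *m Q *m w' - u' *m S *m w' - u' *m Q *m w)
  - j ^+ 3 *: (u' *m Q *m w').
Proof.
rewrite !(mulmxDr, mulmxDl, mulNmx, mulmxN) -?(scalemxAl, scalemxAr).
move: (u *m S *m w) (u *m S *m w') (u *m Q *m w) (u *m Q *m w').
move: (u' *m S *m w) (u' *m S *m w') (u' *m Q *m w) (u' *m Q *m w').
by move=> *; apply/matrixP => k l; rewrite !mxE; ring.
Qed.

(** The imaginary part vanishes since the real part of [A] is symmetric and its
imaginary part skew. *)
Lemma qform_complexify A x : A \is hermsymmx ->
  qform (@Num.conj R[i]) A (complexify x) = real_complex R (bform (real_form A) x x).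
Proof.
move=> hA; have [SE KE] := hermitian_parts hA.
set S := map_mx _ A in SE *; set K := map_mx (@complex.Im R) A in KE *.
pose t := real_complex R; pose u := lsubmx x; pose u' := rsubmx x.
have zE : complexify x = map_mx t u^T + 'i%C *: map_mx t u'^T.
  by apply/matrixP => i j; rewrite !mxE (ord1 j) /t; apply/eqP; rewrite eq_complex /=;
     apply/andP; split; apply/eqP; ring.
have zbE : map_mx (@Num.conj R[i]) (complexify x)^T = map_mx t u - 'i%C *: map_mx t u'.
  apply/matrixP => i j; rewrite !mxE (ord1 i) /t; apply/eqP; rewrite eq_complex /=;
     apply/andP; split; apply/eqP; ring.
have AE : A = map_mx t S + 'i%C *: map_mx t K.
  apply/matrixP => i j; rewrite !mxE /t; case: (A i j) => p q; apply/eqP; rewrite eq_complex /=;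
     apply/andP; split; apply/eqP; ring.
have Kuu (w : 'rV[R]_d) : (w *m K *m w^T) 0 0 = 0.
  have : (w *m K *m w^T)^T = - (w *m K *m w^T).
    by rewrite !trmx_mul trmxK KE mulmxA mulmxN mulNmx.
  by move=> /matrixP/(_ 0 0); rewrite !mxE => h; lra.
have Suu : (u *m S *m u'^T) 0 0 = (u' *m S *m u^T) 0 0.
  by have := bformC u u' SE.
rewrite /qform zbE zE [X in _ *m X *m _]AE.
rewrite mulmx_sandwich_expand -!map_mxM.
have -> : bform (real_form A) x x = (u *m S *m u^T + u' *m S *m u'^T
    + u' *m K *m u^T - u *m K *m u'^T) 0 0.
  rewrite /bform /real_form -/S -/K -[x]hsubmxK -/u -/u' mul_row_block tr_row_mx mul_row_col.
  rewrite !mulmxDl !mulmxN !mulNmx.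
  move: (u *m S *m u^T) (u *m K *m u'^T) (u' *m K *m u^T) (u' *m S *m u'^T).
  by move=> m1 m2 m3 m4; rewrite !mxE; ring.
move: (Kuu u) (Kuu u') Suu.
move: (u *m S *m u^T) (u *m S *m u'^T) (u *m K *m u^T) (u *m K *m u'^T).
move: (u' *m S *m u^T) (u' *m S *m u'^T) (u' *m K *m u^T) (u' *m K *m u'^T).
move=> m1 m2 m3 m4 m5 m6 m7 m8 m70 m40 m61.
rewrite !mxE m70 m40 m61 ['i%C ^+ 3]exprS sqr_i; apply/eqP; rewrite eq_complex /=.
by apply/andP; split; apply/eqP; ring.
Qed.
End Complex.

(** The extra form J, beside the [N] measurements, forces the velocity to be
orthogonal to the phase orbit; it accounts for the bound d + d <= N + 1. *)
Lemma complex_PR_ae_dim (R : realType) (d N : nat) (A : 'I_N -> 'M[R[i]]_d) :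
  (forall j, A j \is hermsymmx) -> complex_PR_ae A -> (2 * d - 1 <= N)%N.
Proof.
move=> hermA PR.
pose J : 'M[R]_(d + d) := quarter_turn.
pose B j := real_form (A j).
pose C (k : 'I_N.+1) := if unlift ord0 k is Some j then B j else J.
pose G := [set x : 'rV[R]_(d + d) |
  phase_retrieval_at (@Num.conj R[i]) (A : 'I_N -> 'M[R[i]]_d) (complexify x)].
suff : (d + d <= N.+1)%N by rewrite mul2n -addnn leq_subLR add1n.
apply: (@dim_le_number_of_forms R (d + d) N B J N.+1 C G).
- by move=> j; exact: real_form_sym.
- move=> x w Cxw; split => [j|].
    by have := Cxw (lift ord0 j); rewrite /C liftK.
  by have := Cxw ord0; rewrite /C unlift_none.
- apply: (dense_of_null PR) => x notbad; apply: contrapT => notG.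
  by apply: notbad; exists (complexify x); rewrite ?complexifyK.
move=> x y Gx yx; have [j|c [c1 yE]] := Gx (complexify y).
  by rewrite !qform_complexify // -/(B j) yx.
exists (complex.Re c), (complex.Im c); split; first exact: complexify_scale.
rewrite (complexify_scale yE); apply: rotation_dist.
by apply: complexI; rewrite add_Re2_Im2 c1 expr1n.
Qed.

Theorem corollary2p2 (R : realType) (d N : nat) :
  (forall A : 'I_N -> 'M[R]_d,
     (forall j, A j \is symmetricmx) -> real_PR_ae A -> (d <= N)%N) /\
  (forall A : 'I_N -> 'M[R[i]]_d,
     (forall j, A j \is hermsymmx) -> complex_PR_ae A -> (2 * d - 1 <= N)%N).
Proof. by split=> A; [exact: real_PR_ae_dim|exact: complex_PR_ae_dim]. Qed.
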